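(* Let $X_t$ and $\check X_{t(z)}$ be a mirror pair of Calabi-Yau threefolds, corresponding to the A- and B-sides of mirror symmetry, thought of as the fibers of corresponding families over a base manifold $\mathcal M$ of dimension $n=h^{1,1}(X_t)=h^{2,1}(\check X_{t(z)})$, with local coordinates $t=\{t^1,\dots,t^n\}$. Let $t_c$ be a coordinate near a singularity at finite distance in the special Kähler metric. Assume that the topological string free energies $F^g$ behave as follows (only the dependence on $t_c$ is displayed): $$F^0(t_c)= b\left( \tfrac{1}{2} t_c^2 \log t_c -\tfrac{3}{4} t_c^2 \right)+ \mathcal{O}(t_c^3),\qquad F^1(t_c)= -\tfrac{b}{12} \log t_c + \mathcal{O}(t_c),$$ $$F^{g}(t_c)= b\, \frac{B_{2g}}{2g (2g-2)\, t_c^{2g-2}} + \mathcal{O}(t_c^0), \qquad g\ge 2 .$$ Let $F(\lambda,t_c)=\sum_{g\ge0}\lambda^{2g-2}F^g(t_c)$. Consider $\Lambda\in\mathbb{C}^*$ and the rescaling $\lambda'=\lambda\cdot\Lambda$, $t_c'=t_c\cdot\Lambda$, and define $$F'(\lambda',t_c') := \lim_{\Lambda\to\infty}\left( F\!\left(\tfrac{\lambda'}{\Lambda},\tfrac{t_c'}{\Lambda}\right) + b\,\frac{(t_c')^2}{2(\lambda')^2}\log\Lambda - \frac{b}{12}\log\Lambda\right).$$ Then $F'$ satisfies the difference equation $$F'(\lambda',t_c'+\lambda') - 2F'(\lambda',t_c') + F'(\lambda',t_c'-\lambda') = b\,\log t_c'.$$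
   Context: $F^g$ is the genus $g$ free energy of topological string theory on the family (in a fixed frame of the line bundle of which the free energies are sections of powers), $\lambda$ is the topological string coupling, and $F(\lambda,t_c)$ is an asymptotic (formal) series in $\lambda$. The assumed behavior of the $F^g$ is motivated by physical expectations, in which the constant is $b=n_H-n_V$, the number of extra massless hypermultiplets minus the number of extra massless vector multiplets at the singularity ($b=1$ for a conifold singularity). $B_n$ are the Bernoulli numbers, $\frac{w}{e^w-1}=\sum_{n\ge0}B_n\frac{w^n}{n!}$. *)

(* Defs.v *)
From HB Require Import structures.
From mathcomp Require Import all_boot all_order all_algebra.
From mathcomp Require Import all_classical all_reals all_analysis.
From mathcomp.real_closed Require Export complex.

Set Implicit Arguments.
Unset Strict Implicit.
Unset Printing Implicit Defensive.

Import Order.TTheory GRing.Theory Num.Theory.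
Import numFieldNormedType.Exports.

Local Open Scope classical_set_scope.
Local Open Scope ring_scope.
Local Open Scope complex_scope.

HB.instance Definition _ (R : rcfType) := GRing.ComAlgebra.copy R[i] R[i]^o.
HB.instance Definition _ (R : rcfType) := Vector.copy R[i] R[i]^o.
HB.instance Definition _ (R : rcfType) := NormedModule.copy R[i] R[i]^o.

(* w / (e^w - 1) = \sum_n B_n w^n / n! as formal power series in w, that is
   (\sum_k B_k w^k / k!) * (\sum_(j >= 1) w^j / j!) = w coefficient by
   coefficient. *)
Definition bernoulli_numbers (B : nat -> rat) :=
  forall n, \sum_(k < n) (B k / (k`!)%:R) * ((n - k)`!)%:R^-1 = (n == 1)%:R.

Lemma bernoulli_numbers_exists : exists B, bernoulli_numbers B.
Proof.
pose step (s : seq rat) : rat := (size s == 0)%:R -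
  \sum_(k < size s) nth 0 s k * (((size s).+1 - k)`!)%:R^-1.
pose bs n := iter n (fun s => rcons s (step s)) [::].
have szb n : size (bs n) = n by elim: n => //= n IH; rewrite size_rcons IH.
pose c k := nth 0 (bs k.+1) k.
have nthb n k : (k < n)%N -> nth 0 (bs n) k = c k.
  elim: n => // n IH; rewrite ltnS leq_eqVlt => /predU1P[->//|kn].
  by rewrite /= nth_rcons szb kn IH.
exists (fun k => c k * (k`!)%:R) => -[|n]; first by rewrite big_ord0.
under eq_bigr do rewrite mulfK ?pnatr_eq0 -?lt0n ?fact_gt0//.
rewrite big_ord_recr/= subSnn invr1 mulr1 {2}/c /= nth_rcons szb ltnn eqxx.
rewrite /step szb [X in X + _ = _](_ : _ = \sum_(k < n)
    nth 0 (bs n) k * ((n.+1 - k)`!)%:R^-1); first by rewrite addrC subrK.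
by apply: eq_bigr => k _; rewrite nthb.
Qed.

Section FreeEnergies.
Variable R : realType.
Local Notation C := R[i].

Definition cexp (z : C) : C :=
  (expR (complex.Re z))%:C * (cos (complex.Im z) +i* sin (complex.Im z)).

(* The free energies are multivalued near t_c = 0, as are log t_c and
   log Lambda.  All functions of t_c are therefore functions on the universal
   cover of C^*, whose points are represented by u = log t_c : C, so that
   t_c = cexp u.  Likewise Lambda in C^* comes with a logarithm:
   Lambda = cexp s, log Lambda = s, and t_c / Lambda is the point u - s. *)

(* t_c --> 0 *)
Definition tc0 : set_system C :=
  [set A | exists2 r : R, 0 < r & forall u, `|cexp u| < r%:C -> A u].

Lemma cexp_ln (x : R) : 0 < x -> cexp (ln x)%:C = x%:C.
Proof.
move=> x0; rewrite /cexp /= lnK ?posrE// cos0 sin0.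
by apply/eqP; rewrite eq_complex /= !(mulr1, mulr0, mul0r, subr0, addr0) !eqxx.
Qed.

#[export] Instance tc0_filter : ProperFilter tc0.
Proof.
split.
  move=> [r r0 /(_ (ln (r / 2))%:C)].
  rewrite cexp_ln ?divr_gt0// normc_def /= expr0n addr0 sqrtr_sqr.
  by apply; rewrite ltcR ger0_norm ?divr_ge0 ?ltW// gtr_pMr// invf_lt1 ?ltr1n.
split => [|A1 A2 [r1 r1_gt0 A1r] [r2 r2_gt0 A2r]|A1 A2 A12 [r r0 Ar]].
- by exists 1.
- exists (Num.min r1 r2); first by rewrite lt_min r1_gt0.
  move=> u ur; split; [apply: A1r|apply: A2r];
    by apply: (lt_le_trans ur); rewrite lecR ge_min lexx ?orbT.
- by exists r => // u /Ar/A12.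
Qed.

Canonical tc0_filter_on := FilterType tc0 tc0_filter.

(* |Lambda| --> oo *)
Definition Lambda_oo : set_system C :=
  [set A | exists M : R, forall s, M%:C < `|cexp s| -> A s].

#[export] Instance Lambda_oo_filter : ProperFilter Lambda_oo.
Proof.
split.
  move=> [M /(_ (ln (`|M| + 1))%:C)].
  have M1 : 0 < `|M| + 1 by rewrite ltr_wpDl.
  rewrite cexp_ln// normc_def /= expr0n addr0 sqrtr_sqr; apply.
  by rewrite ltcR (gtr0_norm M1) (le_lt_trans (ler_norm M))// ltrDl.
split => [|A1 A2 [M1 A1M] [M2 A2M]|A1 A2 A12 [M AM]].
- by exists 0.
- exists (Num.max M1 M2) => s Ms; split; [apply: A1M|apply: A2M];
    by apply: le_lt_trans Ms; rewrite lecR le_max lexx ?orbT.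
- by exists M => s /AM/A12.
Qed.

(* d/dt_c = e^(-u) d/du in the coordinate u = log t_c *)
Definition dtc (f : C -> C) : C -> C := fun u => (cexp u)^-1 * derive1 f u.

(* Formal Laurent series \sum_m lambda^(m - 2) S_m with coefficients functions
   of t_c: S m is the coefficient of lambda^(m - 2). *)
Definition lseries := nat -> C -> C.

(* lambda^(m0 - 2) f *)
Definition lterm (m0 : nat) (f : C -> C) : lseries :=
  fun m u => if m == m0 then f u else 0.

Definition ladd (S T : lseries) : lseries := fun m u => S m u + T m u.

Definition lscale (a : C) (S : lseries) : lseries := fun m u => a * S m u.

(* \sum_g lambda^(2g - 2) F^g *)
Definition genus_series (F : nat -> C -> C) : lseries :=
  fun m u => if odd m then 0 else F m./2 u.

(* S(lambda / Lambda, t_c / Lambda), Lambda = cexp s *)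
Definition lrescale (s : C) (S : lseries) : lseries :=
  fun m u => cexp s ^ (2%:Z - m%:Z) * S m (u - s).

(* S(lambda, t_c + e lambda), by Taylor expansion in t_c: the coefficient of
   lambda^(m - 2) in \sum_k (e lambda)^k / k! (d/dt_c)^k S *)
Definition tc_shift (e : C) (S : lseries) : lseries :=
  fun m u => \sum_(k < m.+1) e ^+ k / (k`!)%:R * iter k dtc (S (m - k)%N) u.

(* F(lambda / Lambda, t_c / Lambda) + b t_c^2 / (2 lambda^2) log Lambda
   - b / 12 log Lambda, Lambda = cexp s *)
Definition regularized (b : C) (F : nat -> C -> C) (s : C) : lseries :=
  ladd (lrescale s (genus_series F))
    (ladd (lterm 0%N (fun u => b * (cexp u ^+ 2 / 2) * s))
          (lterm 2%N (fun=> - (b / 12 * s)))).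

(* F'(lambda, t_c); the limit is taken coefficientwise in lambda *)
Definition Fprime (b : C) (F : nat -> C -> C) : lseries :=
  fun m u => lim (regularized b F s m u @[s --> Lambda_oo]).

End FreeEnergies.

Arguments tc0 {R}.
Arguments Lambda_oo {R}.
Arguments dtc {R} f u.

(* Main.v *)
(* In the limit the error terms vanish and the two logarithmic counterterms make
   the limit exist, so F' consists of the explicit leading terms.  The
   coefficient of lambda^(m-2) in the second difference is a sum of even
   derivatives of the coefficients of lambda^(j-2), j < m.  For m = 2 it is
   (F'^0)'' = b log t_c.  For m > 2 it is a multiple of
   \sum_(j < m) (j - 1) B_j / j! * (1 + (-1)^(m-j)) / (m-j)!, the coefficient of
   w^m in D(w) (e^w + e^-w - 2), where D = w beta' - beta and
   beta = w / (e^w - 1).  Since D = - w^2 e^w / (e^w - 1)^2, that product is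
   - w^2, and the coefficient vanishes. *)
Require Import Defs.
From HB Require Import structures.
From mathcomp Require Import all_boot all_order all_algebra.
From mathcomp Require Import all_classical all_reals all_analysis.
From mathcomp Require Import ring lra zify.

Import Order.TTheory GRing.Theory Num.Theory.
Import numFieldNormedType.Exports.

Local Open Scope classical_set_scope.
Local Open Scope ring_scope.

(** * A Bernoulli identity through truncated power series *)

(** Turns power series identities modulo w^N into divisibility between polynomials, where [ring]
    applies. *)
Lemma dvdXnP (K : fieldType) (N : nat) (p : {poly K}) :
  reflect (forall i, (i < N)%N -> p`_i = 0) ('X^N %| p)%R.
Proof.
apply: (iffP idP) => [/dvdpP[q ->] i iN|p0]; first by rewrite coefMXn iN.
apply/dvdpP; exists (drop_poly N p).
rewrite -{1}(poly_take_drop N p) (_ : take_poly N p = 0) ?add0r//.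
by apply/polyP => i; rewrite coef_take_poly coef0; case: ifP => // /p0.
Qed.

Lemma bernoulli_second_difference (B : nat -> rat) (n : nat) :
  bernoulli_numbers B -> (2 < n)%N ->
  \sum_(k < n) (k%:R - 1) * (B k / (k`!)%:R) *
    ((1 + (-1) ^+ (n - k)) / ((n - k)`!)%:R) = 0.
Proof.
(* Truncating below N = n + 1 keeps the coefficient of w^n; [be], [E], [E'], [D] are the truncations
   of beta, e^w, e^-w and w beta' - beta. *)
move=> HB n2; pose N := n.+1.
pose be : {poly rat} := \poly_(i < N) (B i / (i`!)%:R).
pose E : {poly rat} := \poly_(i < N) (i`!)%:R^-1.
pose E' : {poly rat} := \poly_(i < N) ((-1) ^+ i / (i`!)%:R).
pose D := 'X * be^`() - be.
have coefE' p i : (i < N)%N -> ('X * p^`())`_i = i%:R * p`_i :> rat.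
  by case: i => [|i] _; rewrite coefXM ?mul0r//= coef_deriv mulr_natl.
have H1 : ('X^N %| be * (E - 1) - 'X)%R.
  apply/dvdXnP => i iN; rewrite coefB coefX mulrBr mulr1 coefB coefM.
  rewrite big_ord_recr/= !coef_poly iN subnn mulr1 addrK -(HB i).
  apply/eqP; rewrite subr_eq0; apply/eqP/eq_bigr => k _.
  by rewrite !coef_poly (ltn_trans _ iN)// (leq_ltn_trans _ iN)// leq_subr.
have H2 : ('X^N %| 'X * E^`() - 'X * E)%R.
  apply/dvdXnP => i iN; rewrite coefB coefE'// coefXM.
  case: i iN => [|i] iN; rewrite ?mul0r ?subr0//= !coef_poly iN ltnW//.
  by rewrite factS natrM invfM mulrA divff ?mul1r ?subrr// pnatr_eq0.
have H3 : ('X^N %| E * E' - 1)%R.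
  apply/dvdXnP => i iN; rewrite coefB coef1 coefM.
  (* The Cauchy product is the binomial expansion of (1 - 1)^i / i!. *)
  transitivity ((i`!)%:R^-1 * (1 - 1) ^+ i - (i == 0)%:R :> rat); last first.
    by case: i {iN} => [|i]; rewrite subrr ?expr0 ?expr0n//= ?invr1 ?mulr1 ?mulr0 ?subrr.
  congr (_ - _); rewrite exprDn mulr_sumr [RHS](reindex_inj rev_ord_inj)/=.
  apply: eq_bigr => k _; have ki : (k <= i)%N by rewrite -ltnS.
  rewrite !coef_poly (leq_ltn_trans ki)// (leq_ltn_trans (leq_subr _ _))//.
  rewrite expr1n mul1r subSS bin_sub//.
  rewrite -mulr_natl -(bin_fact ki) !natrM.
  have f0 a : (a`!)%:R != 0 :> rat by rewrite pnatr_eq0 -lt0n fact_gt0.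
  have b0 : ('C(i, k))%:R != 0 :> rat by rewrite pnatr_eq0 -lt0n bin_gt0.
  by field; rewrite !f0 b0.
(* Differentiation may lose one order of vanishing; the factor X restores it. *)
have H4 : ('X^N %| 'X * (be * (E - 1) - 'X)^`())%R.
  apply/dvdXnP => i iN; rewrite coefE'//.
  by move/dvdXnP : H1 => ->//; rewrite mulr0.
(* Modulo w^N: D (e^w - 1) = - w be e^w and (e^w - 1)(1 - e^-w) = e^w + e^-w - 2. *)
have H5 : ('X^N %| D * (E + E' - 1 *+ 2) + 'X^2)%R.
  rewrite (_ : _ + 'X^2 = (1 - E') * ('X * (be * (E - 1) - 'X)^`())
     - (1 - E') * (be * (E - 1) - 'X)
     - (1 - E') * be * ('X * E^`() - 'X * E)
     + D * (E * E' - 1) + 'X * be * (E * E' - 1)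
     - 'X * (be * (E - 1) - 'X)).
    by do !first [done|exact: H4|apply: dvdp_sub|apply: dvdp_add|apply: dvdp_mull].
  rewrite /D derivB derivM derivB derivX -(_ : 1%:P = 1)// derivC subr0.
  by rewrite polyC1; ring.
move/dvdXnP : H5 => /(_ n (ltnSn _)).
(* As n > 2, X^2 does not contribute; the k = n term drops because e^w + e^-w - 2 has no constant
   term. *)
rewrite coefD coefXn gtn_eqF// addr0 coefM big_ord_recr/= subnn.
rewrite !(coefD, coefMn, coefN, coef1) !coef_poly/= fact0 expr0 invr1 mulr1.
rewrite subrr mulr0 addr0 => H; rewrite -[RHS]H.
apply: eq_bigr => k _; rewrite (_ : D`_k = (k%:R - 1) * (B k / k`!%:R)); last first.
  rewrite /D coefB coefE' ?(ltn_trans (ltn_ord k))// coef_poly.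
  by rewrite (ltn_trans (ltn_ord k))//; ring.
rewrite !(coefD, coefMn, coefN, coef1) !coef_poly ltnS leq_subr.
by rewrite subn_eq0 leqNgt ltn_ord mulr0n; ring.
Qed.

(** * The complex exponential and its derivative *)

Section ComplexExponential.
Variable R : realType.
Local Notation C := R[i].
Local Open Scope complex_scope.

Lemma cexpD (z w : C) : cexp (z + w) = cexp z * cexp w.
Proof.
case: z w => [x y] [x' y']; rewrite /cexp /= expRD cosD sinD.
by apply/eqP; rewrite eq_complex /=; apply/andP; split; apply/eqP; ring.
Qed.

Lemma cexp0 : cexp 0 = 1 :> C.
Proof.
rewrite /cexp /= expR0 cos0 sin0; apply/eqP.
by rewrite eq_complex /= !(mulr1, mulr0, mul0r, subr0, addr0) !eqxx.
Qed.

Lemma cexp_neq0 (z : C) : cexp z != 0.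
Proof.
apply/eqP => z0; have := cexpD z (- z); rewrite subrr cexp0 z0 mul0r.
by move/eqP; rewrite oner_eq0.
Qed.

Lemma cexpN (z : C) : cexp (- z) = (cexp z)^-1.
Proof. by apply: (mulIf (cexp_neq0 z)); rewrite -cexpD addNr cexp0 mulVf ?cexp_neq0. Qed.

Lemma cexpB (z w : C) : cexp (z - w) = cexp z / cexp w.
Proof. by rewrite cexpD cexpN. Qed.

Lemma cexp_natmul (n : nat) (z : C) : cexp (n%:R * z) = cexp z ^+ n.
Proof.
elim: n => [|n IH]; first by rewrite mul0r cexp0.
by rewrite -natr1 mulrDl mul1r cexpD IH exprSr.
Qed.

Lemma is_derive_linear_approx (f : R -> R) (l e : R) : is_derive (0 : R) 1 f l -> 0 < e ->
  \forall x \near (0 : R), `|f x - f 0 - l * x| <= e * `|x|.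
Proof.
move=> [fd fl] e0; have : h^-1 *: (f (h *: 1 + 0) - f 0) @[h --> 0^'] --> l.
  by move: fd; rewrite -fl; exact.
move=> /cvgrPdist_le /(_ _ e0); rewrite near_withinE /=; apply: filterS => x.
have [->|x0 /(_ isT)] := eqVneq x 0; first by rewrite subrr mulr0 subr0 !normr0 mulr0.
rewrite addr0 /GRing.scale/= mulr1 => H.
rewrite (_ : _ - _ = - (x * (l - x^-1 * (f x - f 0)))); last by field.
by rewrite normrN normrM mulrC ler_wpM2r.
Qed.

(** With z = x + iy, the error splits as e^x ((cos y - 1) + i (sin y - y)) + (e^x - 1) i y + (e^x -
    1 - x), so real estimates of exp, sin and cos near 0 suffice. *)
Lemma cexp_linear_approx (e : R) : 0 < e ->
  exists2 d : R, 0 < d & forall z : C, `|z| < d%:C ->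
    `|cexp z - 1 - z| <= e%:C * `|z|.
Proof.
(* The pieces add up to at most e' (5 |y| + |x|), hence 6 e' |z|. *)
move=> e0; pose e' := e / 6.
have e'0 : 0 < e' by rewrite divr_gt0.
have /(is_derive_linear_approx _ _ _ ^~ e'0) He : is_derive (0 : R) 1 expR 1.
  by have := is_derive_expR (0 : R); rewrite expR0.
have /(is_derive_linear_approx _ _ _ ^~ e'0) Hs : is_derive (0 : R) 1 sin 1.
  by have := is_derive_sin (0 : R); rewrite cos0.
have /(is_derive_linear_approx _ _ _ ^~ e'0) Hc : is_derive (0 : R) 1 cos 0.
  by have := is_derive_cos (0 : R); rewrite sin0 oppr0.
(* The bound 1 yields |e^x| <= 2; the bound e' controls the cross term (e^x - 1) i y. *)
have Hex : \forall x \near (0 : R), `|expR x - 1| <= Num.min 1 e'.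
  have := @continuous_expR R 0; rewrite /continuous_at expR0.
  move=> /cvgrPdist_le /(_ (Num.min 1 e')).
  rewrite lt_min ltr01 e'0 => /(_ isT) near1; apply: filterS near1 => x.
  by rewrite distrC.
have [d /= d0 Hd] : nbhs (0 : R) [set x : R | [/\ `|expR x - 1 - x| <= e' * `|x|,
  `|sin x - x| <= e' * `|x|, `|cos x - 1| <= e' * `|x| & `|expR x - 1| <= Num.min 1 e']].
  near=> x; split; last by near: x.
  - by have : `|expR x - expR 0 - 1 * x| <= e' * `|x|; [near: x|rewrite expR0 mul1r].
  - by have : `|sin x - sin 0 - 1 * x| <= e' * `|x|; [near: x|rewrite sin0 subr0 mul1r].
  - by have : `|cos x - cos 0 - 0 * x| <= e' * `|x|; [near: x|rewrite cos0 mul0r subr0].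
exists d => // -[x y] zd.
have rD (p q : R) : (p + q)%:C = p%:C + q%:C by rewrite -rmorphD.
have rM (p q : R) : (p * q)%:C = p%:C * q%:C by rewrite -rmorphM.
have nre (r : R) : `|r%:C| = `|r|%:C by rewrite normc_def /= expr0n addr0 sqrtr_sqr.
have ni : `|'i%C : C| = 1 by rewrite normc_def /= expr0n expr1n add0r sqrtr1.
have xz : `|x|%:C <= `|x +i* y| by have := normc_ge_Re (x +i* y).
have yz : `|y|%:C <= `|x +i* y|.
  by rewrite normc_def lecR/= -sqrtr_sqr ler_wsqrtr// lerDr sqr_ge0//.
have dx : `|x| < d by rewrite -ltcR (le_lt_trans xz).
have dy : `|y| < d by rewrite -ltcR (le_lt_trans yz).
have [|h1 _ _ h4] := Hd x; first by rewrite /= sub0r normrN.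
have [|_ h2 h3 _] := Hd y; first by rewrite /= sub0r normrN.
move: h4; rewrite le_min => /andP[h4 h5].
have ex2 : `|expR x| <= 2.
  by rewrite -(subrK 1 (expR x)) (le_trans (ler_normD _ _))// normr1 -[leRHS]/(1+1) lerD2r.
rewrite (_ : cexp _ - 1 - _ = (expR x)%:C * ((cos y - 1)%:C + 'i%C * (sin y - y)%:C) +
   ((expR x - 1)%:C * ('i%C * y%:C) + (expR x - 1 - x)%:C)); last first.
  by rewrite /cexp/=; apply/eqP; rewrite eq_complex/=; apply/andP; split; apply/eqP; ring.
apply: (@le_trans _ _ (2 * (e' * `|y| + e' * `|y|) + (e' * `|y| + e' * `|x|))%:C).
  apply: (le_trans (ler_normD _ _)); rewrite [leRHS]rD lerD//.
    rewrite normrM nre [leRHS]rM ler_pM ?normr_ge0//;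
      [by rewrite lecR normr_ge0|by rewrite lecR|].
    apply: (le_trans (ler_normD _ _)); rewrite [leRHS]rD.
    by rewrite normrM ni mul1r !nre lerD ?lecR.
  apply: (le_trans (ler_normD _ _)); rewrite [leRHS]rD !normrM ni mul1r !nre.
  by rewrite lerD ?lecR// -rM lecR ler_wpM2r.
rewrite (_ : _ + _ = e' * (5 * `|y| + `|x|)); last by ring.
have -> : e = e' * 6 by rewrite /e'; field.
clearbody e'.
rewrite !rM -mulrA; apply: ler_wpM2l; first by rewrite lecR ltW.
rewrite rD rM (_ : 6%:C = 5%:C + 1); last by rewrite -rD; congr _%:C; ring.
by rewrite mulrDl mul1r; apply: lerD => //; apply: ler_wpM2l => //; rewrite lecR ler0n.
Unshelve. all: by end_near. Qed.

Lemma gt0_complexE (e : C) : 0 < e -> e = (complex.Re e)%:C /\ 0 < complex.Re e.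
Proof. by case: e => x y; rewrite ltcE/= => /andP[/eqP-> ->]. Qed.

(** The functional equation moves the difference quotient at u to the linear approximation at 0. The
    factor z serves the powers t_c^z. *)
Lemma is_derive_cexp_scale (z u : C) :
  is_derive u 1 (fun v => cexp (z * v)) (z * cexp (z * u)).
Proof.
have H : h^-1 *: (cexp (z * (h *: 1 + u)) - cexp (z * u)) @[h --> (0 : C)^']
    --> z * cexp (z * u).
  (* Precision e / A leaves an error of at most e (A - 1) / A; the + 1 keeps A positive even for z =
     0. *)
  apply/cvgrPdist_le => e e0; pose A := `|cexp (z * u)| * `|z| + 1.
  have A0 : 0 < A by rewrite ltr_wpDl// mulr_ge0.
  have [eE e'0] := gt0_complexE _ (divr_gt0 e0 A0).
  have [d d0 Hd] := cexp_linear_approx _ e'0.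
  have z0 : 0 < `|z| + 1 by rewrite ltr_wpDl.
  rewrite near_withinE; near=> h => h0.
  have hd : `|h| < d%:C / (`|z| + 1).
    by near: h; apply: nbhs0_lt; rewrite divr_gt0// ltcR.
  have zh : `|z * h| < d%:C.
    rewrite normrM; apply: le_lt_trans (_ : (`|z| + 1) * `|h| < _).
      by rewrite ler_wpM2r// lerDl.
    by rewrite mulrC -ltr_pdivlMr.
  have := Hd _ zh; rewrite -eE => {}Hd.
  rewrite /GRing.scale/= mulr1 (mulrDr z) cexpD.
  rewrite (_ : _ - _ = - (cexp (z * u) * (cexp (z * h) - 1 - z * h) / h)); last first.
    by field.
  rewrite normrN normrM normfV (normrM (cexp (z * u))) ler_pdivrMr ?normr_gt0//.
  apply: le_trans (ler_wpM2l _ Hd) _ => //.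
  rewrite [`|z * h|]normrM (_ : _ * _ = e * `|h| * ((A - 1) / A)); last first.
    by rewrite /A; field; rewrite -/A gt_eqF.
  apply: ler_piMr; first by rewrite mulr_ge0 ?normr_ge0 ?ltW.
  by rewrite ler_pdivrMr ?mul1r ?gerBl ?ler01.
split; first exact: cvgP H.
exact: (cvg_lim (@norm_hausdorff _ _)) H.
Unshelve. all: by end_near. Qed.

End ComplexExponential.

(* (a log t_c + c) t_c^z: the closure under d/dt_c of the functions occurring in F'. *)
Definition log_monomial {R : realType} (a c z : R[i]) : R[i] -> R[i] :=
  fun u => (a * u + c) * cexp (z * u).

(** * Iterated t_c-derivatives of log monomials *)

Section LogMonomial.
Variable R : realType.
Local Notation C := R[i].
Implicit Types a c z u : C.

Lemma is_derive_log_monomial a c z u : is_derive u 1 (log_monomial a c z)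
  ((z * a * u + (z * c + a)) * cexp (z * u)).
Proof.
have H1 := is_derive_cexp_scale R z u.
have H2 : is_derive u 1 (fun v : C => a * v + c) a.
  have := is_deriveD (is_deriveZ a (is_derive_id u 1)) (is_derive_cst c u 1).
  by rewrite addr0 /GRing.scale/= mulr1.
have := is_deriveM H2 H1; rewrite /GRing.scale/= => H.
rewrite (_ : _ * _ = (a * u + c) * (z * cexp (z * u)) + cexp (z * u) * a)//.
by ring.
Qed.

Lemma dtc_log_monomial a c z :
  dtc (log_monomial a c z) = log_monomial (z * a) (z * c + a) (z - 1).
Proof.
apply/funext => u; rewrite /dtc derive1E.
have [_ ->] := is_derive_log_monomial a c z u.
by rewrite /log_monomial mulrBl mul1r cexpB; ring.
Qed.

Lemma iter_dtc_log_monomial k a c z : exists a' c' z',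
  iter k dtc (log_monomial a c z) = log_monomial a' c' z'.
Proof.
elim: k => [|k [a' [c' [z' IH]]]]; first by exists a, c, z.
by rewrite iterS IH dtc_log_monomial; do 3!eexists.
Qed.

Lemma iter_dtc_monomial k c z : iter k dtc (log_monomial 0 c z) =
  log_monomial 0 (c * \prod_(i < k) (z - i%:R)) (z - k%:R).
Proof.
elim: k => [|k IH]; first by rewrite big_ord0 mulr1 subr0.
rewrite iterS IH dtc_log_monomial mulr0 addr0 big_ord_recr/= -addrA -opprD natr1.
by congr log_monomial; ring.
Qed.

(** The product is the falling factorial of -(p + 1), which is the coefficient in the k-th
    derivative of t_c^(-p-1). *)
Lemma fact_falling_neg (p k : nat) :
  (p`!)%:R * \prod_(i < k) (- (p.+1)%:R - i%:R) = (-1) ^+ k * ((p + k)`!)%:R :> C.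
Proof.
elim: k => [|k IH]; first by rewrite big_ord0 addn0 mulr1 mul1r.
rewrite big_ord_recr/= mulrA IH exprS addnS factS natrM.
rewrite (_ : (p + k).+1%:R = p.+1%:R + k%:R); first by ring.
by rewrite -natrD addSn.
Qed.

End LogMonomial.

(** * The rescaling limit of a function known up to an error term *)

Section Limit.
Variable R : realType.
Local Notation C := R[i].
Local Open Scope complex_scope.
Implicit Types (f M r corr : C -> C) (u s : C).

Lemma near_Lambda_oo (x : C) : 0 <= x -> \forall s \near Lambda_oo, x < `|cexp s|.
Proof.
move=> x0; exists (complex.Re x) => s; suff -> : (complex.Re x)%:C = x by [].
by case: x x0 => a c; rewrite lecE/= => /andP[/eqP->].
Qed.

(** Since r(u - s) is O((t_c / Lambda)^p), the product is O(Lambda^(e - p)) with e < p. Both filters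
    see only moduli, so the estimate is uniform in the branch of log Lambda. *)
Lemma rescaled_bigO_cvg0 r (p : nat) (e : int) u :
  (exists2 k : C, 0 < k & \forall v \near tc0, `|r v| <= k * `|cexp v ^+ p|) ->
  e < p%:Z -> cexp s ^ e * r (u - s) @[s --> Lambda_oo] --> (0 : C).
Proof.
move=> [k k0 [d d0 Hd]] ep; apply/cvgr0Pnorm_le => eps eps0.
have dC : 0 < d%:C by rewrite ltcR.
near=> s.
have s1 : 1 < `|cexp s| by near: s; exact: near_Lambda_oo.
have s2 : `|cexp u| / d%:C < `|cexp s|.
  by near: s; apply: near_Lambda_oo; rewrite divr_ge0 ?normr_ge0// ltW.
(* The final bound is k |t_c|^p / |Lambda|^(q+1), and |Lambda|^(q+1) >= |Lambda| because |Lambda| >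
   1. *)
have s3 : k * `|cexp u| ^+ p / eps < `|cexp s|.
  near: s; apply: near_Lambda_oo.
  by rewrite divr_ge0 ?mulr_ge0 ?exprn_ge0 ?normr_ge0 ?ltW.
have s0 : 0 < `|cexp s| by rewrite normr_gt0 cexp_neq0.
have /Hd : `|cexp (u - s)| < d%:C.
  by rewrite cexpB normrM normfV ltr_pdivrMr// mulrC -ltr_pdivrMr.
rewrite cexpB exprMn exprVn !normrM normfV !normrX => Hr.
have [q eq] : exists q : nat, p%:Z = e + q.+1%:Z.
  by exists (absz (p%:Z - e - 1)%R); lia.
have -> : e = p%:Z - q.+1%:Z by lia.
rewrite expfzDr ?cexp_neq0// -exprnP -exprnN normrM normfV !normrX.
apply: le_trans (ler_wpM2l _ Hr) _.
  by rewrite mulr_ge0 ?invr_ge0 ?exprn_ge0.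
rewrite [leLHS](_ : _ = k * `|cexp u| ^+ p / `|cexp s| ^+ q.+1); last first.
  by field; rewrite !expf_neq0 ?gt_eqF.
rewrite ler_pdivrMr ?exprn_gt0// [leRHS]mulrC -ler_pdivrMr//.
apply: (le_trans (ltW s3)); rewrite exprS ler_peMr ?(ltW s0)//.
by rewrite exprn_ege1 ?(ltW s1).
Unshelve. all: by end_near. Qed.

(** The rescaled leading term and its correction add up to l exactly, for every s, so only the
    remainder is left to the limit. *)
Lemma rescaled_bigO_cvg f M (p : nat) (e : int) corr (l : C) u :
  f = M +O_tc0 (fun v => cexp v ^+ p) -> e < p%:Z ->
  (forall s, cexp s ^ e * M (u - s) + corr s = l) ->
  cexp s ^ e * f (u - s) + corr s @[s --> Lambda_oo] --> l.
Proof.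
move=> /eqaddOP fM ep Hl.
have [k [kreal Hk]] := fM.
have H0 : cexp s ^ e * (f - M) (u - s) @[s --> Lambda_oo] --> (0 : C).
  apply: (@rescaled_bigO_cvg0 _ p) => //; exists (`|k| + 1); first by rewrite ltr_wpDl.
  by apply: Hk; rewrite (le_lt_trans (real_ler_norm kreal))// ltrDl.
rewrite -[l]add0r.
rewrite (_ : (fun s => _ + _) = (fun s => cexp s ^ e * (f - M) (u - s) + l)).
  by apply: cvgD H0 _; exact: cvg_cst.
by apply/funext => s; rewrite -(Hl s) !fctE; ring.
Qed.

End Limit.

(** * The limit F' and its second difference *)

Section DifferenceEquation.
Variables (R : realType) (B : nat -> rat) (b : R[i]) (F : nat -> R[i] -> R[i]).
Local Notation C := R[i].
Implicit Types (u s : C) (m : nat).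
Hypothesis B_bernoulli : bernoulli_numbers B.
Hypothesis F0_tc0 :
  F 0%N = (fun u => b * (1 / 2 * cexp u ^+ 2 * u - 3 / 4 * cexp u ^+ 2))
            +O_tc0 (fun u => cexp u ^+ 3).
Hypothesis F1_tc0 : F 1%N = (fun u => - (b / 12) * u) +O_tc0 (fun u => cexp u).
Hypothesis Fg_tc0 : forall g, (2 <= g)%N ->
  F g = (fun u => b * (ratr (B (2 * g)%N) /
            ((2 * g) * (2 * g - 2))%N%:R / cexp u ^+ (2 * g - 2)))
          +O_tc0 (fun u => cexp u ^+ 0).

(** The leading term of genus g = m / 2. Even the zero of odd orders is written as a log monomial,
    so that all orders share one shape. *)
Definition Fprime_coef m : C -> C :=
  if odd m then log_monomial 0 0 0
  else if m == 0 then log_monomial (b / 2) (- (3 / 4 * b)) 2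
  else if m == 2 then log_monomial (- (b / 12)) 0 0
  else log_monomial 0 (b * (ratr (B m) / (m * (m - 2))%N%:R)) (- (m - 2)%N%:R).

(** Replacing log t_c by u - s produces - b t_c^2 s / 2 in genus 0 and b s / 12 in genus 1, which
    the counterterms cancel; for g >= 2 the leading term is homogeneous and absorbs Lambda^(2-2g).
    The errors vanish since 2 < 3, 0 < 1 and 2 - 2g < 0 respectively. *)
Lemma regularized_cvg m u :
  regularized b F s m u @[s --> Lambda_oo] --> Fprime_coef m u.
Proof.
rewrite /regularized /ladd /lrescale /lterm /genus_series /Fprime_coef /log_monomial.
have n0 s := cexp_neq0 R s.
have [modd|meven] := boolP (odd m).
  have [m0 m2] : m == 0 = false /\ m == 2 = false by case: m modd => [|[|[|]]].
  rewrite m0 m2 !mul0r addr0 (_ : (fun s => _) = cst (0 * cexp 0)); first exact: cvg_cst.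
  by apply/funext => s; rewrite mulr0 !addr0 mul0r.
have [->|m0] := eqVneq m 0.
  apply: (@rescaled_bigO_cvg _ _ _ _ (2%:Z - 0%:Z)
    (fun s => b * (cexp u ^+ 2 / 2) * s + 0) _ _ F0_tc0) => // s.
  rewrite (_ : 2%:Z - 0 = 2) // -exprnP cexpB (cexp_natmul _ 2) addr0.
  by field; rewrite n0.
have [->|m2] := eqVneq m 2.
  apply: (@rescaled_bigO_cvg _ _ _ 1 (2%:Z - 2%:Z)
    (fun s => 0 - (b / 12 * s)) _ _ F1_tc0) => // s.
  by rewrite subrr expr0z mul0r cexp0; field.
have g2 : (2 <= m./2)%N by case: m meven m0 m2 => [|[|[|[|]]]].
have mE : (2 * m./2)%N = m by rewrite mul2n halfK (negbTE meven) subn0.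
apply: (@rescaled_bigO_cvg _ _ _ _ (2%:Z - m%:Z) (fun=> 0 + 0) _ _ (Fg_tc0 _ g2)).
  by lia.
rewrite mE => s; rewrite mulNr cexpN cexp_natmul cexpB.
have -> : 2%:Z - m%:Z = - (m - 2)%N%:Z by lia.
rewrite -exprnN mul0r expr_div_n natrM add0r !addr0 add0r.
by field; rewrite !expf_neq0// !pnatr_eq0; lia.
Qed.

Lemma FprimeE : Fprime b F = Fprime_coef.
Proof.
apply/funext => m; apply/funext => u.
exact: (cvg_lim (@norm_hausdorff _ _)) (regularized_cvg m u).
Qed.

(* The genera 0, 1 and >= 2 obey one formula: their three shapes all become
   (j - 1) B_j / j! up to a factor independent of j. *)
Lemma iter_dtc_Fprime_coef m j : (2 < m)%N -> (j < m)%N -> ~~ odd j ->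
  iter (m - j) dtc (Fprime_coef j) =
  log_monomial 0 ((-1) ^+ (m - j) * b * ((m - 3)`!)%:R * ((j%:R - 1) *
     ratr (B j / (j`!)%:R))) (2 - m%:R).
Proof.
(* Genus 0 and 1 carry explicit constants, to be matched with B_0 = 1 and B_2 = 1/6. *)
move=> m2 jm jeven; have B0 : B 0%N = 1.
  by have := B_bernoulli 1; rewrite big_ord_recr big_ord0/= add0r !divr1.
have B2 : B 2%N = 6^-1.
  have := B_bernoulli 3; have := B_bernoulli 2.
  rewrite !big_ord_recr !big_ord0/= B0 -[(1 + 1)%R]/2%N !subSS !subn0.
  rewrite (_ : 3`! = 6%N)// (_ : 2`! = 2%N)// (_ : 1`! = 1%N)// fact0; lra.
have fallingE p k : \prod_(i < k) (- (p.+1)%:R - i%:R) =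
    (-1) ^+ k * ((p + k)`!)%:R / (p`!)%:R :> C.
  by rewrite -fact_falling_neg mulrC mulKf// pnatr_eq0 -lt0n fact_gt0.
rewrite /Fprime_coef (negbTE jeven).
have [j0|j0] := eqVneq j 0.
  (* As m > 2, at least three derivatives act; the first three remove the logarithm and leave b /
     t_c. *)
  subst j; have [k ->] : exists k, m = k.+3 by exists (m - 3)%N; lia.
  rewrite subn0 !iterSr !dtc_log_monomial (_ : log_monomial _ _ _ = log_monomial 0 b (- 1%:R)).
    rewrite iter_dtc_monomial fallingE add0n fact0 !subSS !subn0 B0 divr1 rmorph1.
    congr log_monomial; first by rewrite !exprS; field.
    by rewrite -[k.+3]addn3 natrD; ring.
  by congr log_monomial; field.
have [j2|j2] := eqVneq j 2.
  (* Here the first derivative already leaves - (b / 12) / t_c. *)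
  subst j; have [k ->] : exists k, m = k.+3 by exists (m - 3)%N; lia.
  rewrite !subSS !subn0 iterSr dtc_log_monomial.
  rewrite (_ : log_monomial _ _ _ = log_monomial 0 (- (b / 12)) (- 1%:R)).
    rewrite iter_dtc_monomial fallingE add0n fact0 B2 rmorphM/= !fmorphV !rmorph_nat.
    congr log_monomial; first by rewrite !exprS (_ : 2`! = 2)//; field.
    by rewrite -[k.+3]addn3 natrD; ring.
  by congr log_monomial; ring.
have j3 : (2 < j)%N by case: j jeven j0 j2 {jm} => [|[|[|]]].
(* The exponent is now -(i + 1), so k = m - j derivatives give (-1)^k (i + k)! / i!, and i + k = m -
   3 is independent of j. *)
have [i jE] : exists i, j = i.+3 by exists (j - 3)%N; lia.
have [k mE] : exists k, m = (k + j)%N by exists (m - j)%N; lia.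
rewrite iter_dtc_monomial mE jE !subSS subn0 fallingE.
rewrite (_ : k + i.+3 - i.+3 = k)%N; last by lia.
rewrite (_ : k + i.+3 - 3 = i + k)%N; last by lia.
congr log_monomial; last first.
  by rewrite natrD -[i.+3]addn3 -[i.+1]addn1 !natrD; ring.
rewrite rmorphM/= fmorphV rmorph_nat !factS !natrM.
have f0 : (i`!)%:R != 0 :> C by rewrite pnatr_eq0 -lt0n fact_gt0.
have n0 l : l.+1%:R != 0 :> C by rewrite pnatr_eq0.
have := (n0 i, n0 i.+1, n0 i.+2).
rewrite -[i.+3]addn3 -[i.+2]addn2 -[i.+1]addn1 !natrD => -[[i1 i2] i3].
by field; rewrite f0 i1 i2 i3.
Qed.

(** The Taylor terms of order zero cancel as 1 - 2 + 1, which leaves j < m. *)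
Lemma tc_shift_second_difference (T : lseries R) m u :
  ladd (tc_shift 1 T) (ladd (lscale (- 2) T) (tc_shift (- 1) T)) m u =
  \sum_(j < m) (1 + (-1) ^+ (m - j)) / ((m - j)`!)%:R * iter (m - j) dtc (T j) u.
Proof.
rewrite /ladd /lscale /tc_shift !big_ord_recl/= subn0 fact0 !expr0 !divr1 !mul1r.
rewrite (_ : forall a x y, a + x + (- 2 * a + (a + y)) = x + y :> C); last first.
  by move=> a x y; ring.
rewrite -big_split [RHS](reindex_inj rev_ord_inj)/=; apply: eq_bigr => k _.
by rewrite subKn// expr1n -mulrDl -mulrDl.
Qed.

Lemma Fprime_coef_difference :
  ladd (tc_shift 1 Fprime_coef)
    (ladd (lscale (- 2) Fprime_coef) (tc_shift (- 1) Fprime_coef))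
  = lterm 2 (fun u => b * u).
Proof.
apply/funext => m; apply/funext => u; rewrite tc_shift_second_difference /lterm.
have odd0 k : odd k -> 1 + (-1) ^+ k = 0 :> C.
  by move=> ok; rewrite -signr_odd ok expr1 subrr.
(* For odd m, either m - j is odd and the factor vanishes, or j is odd and the coefficient of F'
   does. *)
have [modd|meven] := boolP (odd m).
  have /negbTE -> : m != 2 by apply: contraTneq modd => ->.
  apply: big1 => j _; have [/odd0 ->|mj] := boolP (odd (m - j)).
    by rewrite !mul0r.
  have jodd : odd j by move: mj; rewrite oddB 1?ltnW// modd; case: odd.
  rewrite /Fprime_coef jodd iter_dtc_monomial /log_monomial.
  by rewrite !(mul0r, addr0, mulr0).
have [->|m2] := eqVneq m 2.
  rewrite big_ord_recr big_ord1/= subn0 subn1 (odd0 1)// !mul0r addr0.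
  rewrite /Fprime_coef/= !dtc_log_monomial /log_monomial.
  rewrite (_ : 2 - 1 - 1 = 0); last by ring.
  by rewrite mul0r cexp0 sqrrN expr1n (_ : 2`! = 2%N)//; field.
have [m0|m_gt2] : m = 0 \/ (2 < m)%N by lia.
  by subst m; rewrite big_ord0.
have /(congr1 (fun q => ratr q : C)) := bernoulli_second_difference B m B_bernoulli m_gt2.
(* The multiplier is the factor common to all even j in [iter_dtc_Fprime_coef]. *)
rewrite rmorph_sum rmorph0 => /(congr1 (fun x => b * ((m - 3)`!)%:R * cexp ((2 - m%:R) * u) * x)).
rewrite mulr0 mulr_sumr => S0; rewrite -[RHS]S0; apply: eq_bigr => j _.
rewrite !(rmorphM, rmorphB, rmorphD, rmorphXn, rmorphN, rmorph1, rmorph_nat, fmorphV)/=.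
have [mj|mj] := boolP (odd (m - j)); first by rewrite odd0// !(mul0r, mulr0).
have jeven : ~~ odd j by move: mj; rewrite oddB 1?ltnW// (negbTE meven).
rewrite iter_dtc_Fprime_coef// /log_monomial -signr_odd (negbTE mj) expr0.
rewrite !(rmorphM, rmorph_nat, fmorphV)/=.
by rewrite mul0r add0r mul1r !mulrA; ring.
Qed.

End DifferenceEquation.

(** The parameter y stands for the n - 1 coordinates other than t_c. As [lim] and [derive1] are
    total functions, convergence and differentiability are asserted too, so that the difference
    equation concerns genuine limits and derivatives. *)
Theorem corollary3p2 (R : realType) (n : nat) (B : nat -> rat) (b : R[i])
  (U : set 'rV[R[i]]_n.-1) (F : nat -> 'rV[R[i]]_n.-1 -> R[i] -> R[i])
  (n_gt0 : (0 < n)%N)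
  (B_bernoulli : bernoulli_numbers B)
  (F0_tc0 : forall y, U y ->
     F 0%N y = (fun u => b * (1 / 2 * cexp u ^+ 2 * u - 3 / 4 * cexp u ^+ 2))
             +O_tc0 (fun u => cexp u ^+ 3))
  (F1_tc0 : forall y, U y ->
     F 1%N y = (fun u => - (b / 12) * u) +O_tc0 (fun u => cexp u))
  (Fg_tc0 : forall g, (2 <= g)%N -> forall y, U y ->
     F g y = (fun u => b * (ratr (B (2 * g)%N) /
                 ((2 * g) * (2 * g - 2))%N%:R / cexp u ^+ (2 * g - 2)))
             +O_tc0 (fun u => cexp u ^+ 0)) :
  forall y, U y ->
  let F' := Fprime b (F ^~ y) in
  [/\ forall m u, cvg (regularized b (F ^~ y) s m u @[s --> Lambda_oo]),
      forall m k u, derivable (iter k dtc (F' m)) u 1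
    & ladd (tc_shift 1 F') (ladd (lscale (- 2) F') (tc_shift (- 1) F'))
      = lterm 2%N (fun u => b * u)].
Proof.
move=> y Uy F'; have F0y := F0_tc0 y Uy; have F1y := F1_tc0 y Uy.
have Fgy g (g2 : (2 <= g)%N) := Fg_tc0 g g2 y Uy.
have F'E : F' = Fprime_coef R B b by exact: FprimeE F0y F1y Fgy.
split => [m u|m k u|].
- by apply: cvgP; exact: regularized_cvg F0y F1y Fgy m u.
- have [a [c [z F'm]]] : exists a c z, F' m = log_monomial a c z.
    by rewrite F'E /Fprime_coef; do ?[case: ifP => _]; do 3!eexists.
  rewrite F'm; have [a' [c' [z' ->]]] := iter_dtc_log_monomial R k a c z.
  by have [] := is_derive_log_monomial R a' c' z' u.
- by rewrite F'E; exact: Fprime_coef_difference.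
Qed.
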